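(* Given an instance with $n$ agents, consisting of a finite bipartite graph $G=(U,W;E)$, preference valuations $p_v$ for $v\in U\cup W$, and numbers $\gamma_e^v>0$ for each edge $e\in E$ and endpoint $v$ of $e$, and given a matching $M$ of $G$, it can be decided in $O(n^3)$ time whether $M$ is $\gamma$-popular.
   Context: $n=|U\cup W|$ is the number of agents (vertices). $E(v)$ is the set of edges incident to $v$. A matching is a set $M\subseteq E$ with $|M\cap E(v)|\le1$ for all $v$; $M(v)$ is the edge of $M$ at $v$, or $\emptyset$. Each agent $v$ has a valuation $p_v:E(v)\to\mathbb{R}_{\ge0}$, with $p_v(\emptyset)=-\infty$ (and $-\infty+r=-\infty$ for real $r$). For matchings $M,N$ and an agent $v$: $\mathrm{vote}^{\gamma}_v(M,N)=0$ if $M(v)=N(v)$. If $M(v)\neq N(v)$, then with $e=N(v)$ (and $\gamma_\emptyset^v:=0$), $\mathrm{vote}^{\gamma}_v(M,N)=-1$ if $p_v(e)\ge p_v(M(v))+\gamma_e^v$, and $\mathrm{vote}^{\gamma}_v(M,N)=+1$ otherwise. $M$ is $\gamma$-popular if $\sum_{v\in U\cup W}\mathrm{vote}^{\gamma}_v(M,N)\ge0$ for every matching $N$. *)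

(* Defs.v *)
From HB Require Import structures.
From mathcomp Require Import all_boot all_order all_algebra.
From mathcomp Require Import reals constructive_ereal.

Set Implicit Arguments.
Unset Strict Implicit.
Unset Printing Implicit Defensive.

Import Order.TTheory GRing.Theory Num.Theory.
Local Open Scope ring_scope.

Section Popularity.
Variables (R : realType) (U W : finType).

(* A bipartite graph is an edge set E : {set U * W}; the agents are U + W. *)

Definition incident (v : U + W) (e : U * W) : bool :=
  match v with inl u => e.1 == u | inr w => e.2 == w end.

Definition edges_at (E : {set U * W}) (v : U + W) : {set U * W} :=
  [set e in E | incident v e].

Definition is_matching (E M : {set U * W}) : Prop :=
  M \subset E /\ forall v : U + W, (#|M :&: edges_at E v| <= 1)%N.

(* M(v), with None for the empty set. *)
Definition edge_of (M : {set U * W}) (v : U + W) : option (U * W) :=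
  [pick e in M | incident v e].

(* Valuations and thresholds are total functions, but p v e and gamma v e are
   only meaningful when e is an edge incident to v. *)
Variables (p gamma : U + W -> U * W -> R).

Definition valuation (v : U + W) (o : option (U * W)) : \bar R :=
  if o is Some e then (p v e)%:E else -oo%E.

Definition threshold (v : U + W) (o : option (U * W)) : R :=
  if o is Some e then gamma v e else 0.

Definition vote (M N : {set U * W}) (v : U + W) : int :=
  if edge_of M v == edge_of N v then 0
  else if (valuation v (edge_of M v) + (threshold v (edge_of N v))%:E
             <= valuation v (edge_of N v))%E
  then -1 else 1.

Definition popular (E M : {set U * W}) : Prop :=
  forall N : {set U * W}, is_matching E N ->
    0 <= \sum_(v : (U + W)%type) vote M N v.

End Popularity.

(* The machine: a unit-cost random access machine with an integer memory and a
   real memory, programmed in a while-language.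
   - Each memory is a fixed family of one-dimensional arrays: a cell is named by
     an array number, which is constant in the program, and a computed index.
   - Integers are machine words: a computation yielding an integer of absolute
     value larger than the word bound B is stuck.
   - Reals may only be added, subtracted and compared.  In particular they are
     never converted to integers, and there are no real constants, so that a
     program does not depend on the field of reals.  *)

Inductive iexp :=
  | IConst of int
  | IGet of nat & iexp
  | IAdd of iexp & iexp
  | ISub of iexp & iexp
  | IMul of iexp & iexp.

Inductive rexp :=
  | RGet of nat & iexp
  | RAdd of rexp & rexp
  | RSub of rexp & rexp.

Inductive bexp :=
  | ILe of iexp & iexp
  | RLe of rexp & rexp
  | BNot of bexp
  | BAnd of bexp & bexp.

Inductive com :=
  | Skip
  | ISet of nat & iexp & iexp   (* array, index, new content *)
  | RSet of nat & iexp & rexp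
  | Seq of com & com
  | If of bexp & com & com
  | While of bexp & com.

Fixpoint icost (e : iexp) : nat :=
  match e with
  | IConst _ => 1
  | IGet _ i => (icost i).+1
  | IAdd e1 e2 | ISub e1 e2 | IMul e1 e2 => (icost e1 + icost e2).+1
  end.

Fixpoint rcost (e : rexp) : nat :=
  match e with
  | RGet _ i => (icost i).+1
  | RAdd e1 e2 | RSub e1 e2 => (rcost e1 + rcost e2).+1
  end.

Fixpoint bcost (b : bexp) : nat :=
  match b with
  | ILe e1 e2 => (icost e1 + icost e2).+1
  | RLe e1 e2 => (rcost e1 + rcost e2).+1
  | BNot b1 => (bcost b1).+1
  | BAnd b1 b2 => (bcost b1 + bcost b2).+1
  end.

Section Semantics.
Variables (R : realType) (B : nat).

Record state := State {
  imem : nat -> nat -> int;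
  rmem : nat -> nat -> R }.

Definition word (z : int) : option int :=
  if (absz z <= B)%N then Some z else None.

Definition address (z : int) : option nat :=
  if z is Posz k then Some k else None.

Definition lift2 (X Y Z : Type) (f : X -> Y -> option Z)
    (x : option X) (y : option Y) : option Z :=
  obind (fun a => obind (f a) y) x.

Fixpoint ieval (s : state) (e : iexp) : option int :=
  match e with
  | IConst z => word z
  | IGet a i => omap (imem s a) (obind address (ieval s i))
  | IAdd e1 e2 => lift2 (fun x y => word (x + y)) (ieval s e1) (ieval s e2)
  | ISub e1 e2 => lift2 (fun x y => word (x - y)) (ieval s e1) (ieval s e2)
  | IMul e1 e2 => lift2 (fun x y => word (x * y)) (ieval s e1) (ieval s e2)
  end.

Fixpoint reval (s : state) (e : rexp) : option R :=
  match e with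
  | RGet a i => omap (rmem s a) (obind address (ieval s i))
  | RAdd e1 e2 => lift2 (fun x y => Some (x + y)) (reval s e1) (reval s e2)
  | RSub e1 e2 => lift2 (fun x y => Some (x - y)) (reval s e1) (reval s e2)
  end.

Fixpoint beval (s : state) (b : bexp) : option bool :=
  match b with
  | ILe e1 e2 => lift2 (fun x y => Some (x <= y)) (ieval s e1) (ieval s e2)
  | RLe e1 e2 => lift2 (fun x y => Some (x <= y)) (reval s e1) (reval s e2)
  | BNot b1 => omap negb (beval s b1)
  | BAnd b1 b2 => lift2 (fun x y => Some (x && y)) (beval s b1) (beval s b2)
  end.

Definition update (X : Type) (m : nat -> nat -> X) (a k : nat) (x : X) :=
  fun a' k' => if (a' == a) && (k' == k) then x else m a' k'.

(* exec c s t s': started in s, c halts in s' after t unit-cost operations. *)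
Inductive exec : com -> state -> nat -> state -> Prop :=
  | ExecSkip s : exec Skip s 1 s
  | ExecISet s a i e k z :
      obind address (ieval s i) = Some k -> ieval s e = Some z ->
      exec (ISet a i e) s (icost i + icost e).+1
        (State (update (imem s) a k z) (rmem s))
  | ExecRSet s a i e k x :
      obind address (ieval s i) = Some k -> reval s e = Some x ->
      exec (RSet a i e) s (icost i + rcost e).+1
        (State (imem s) (update (rmem s) a k x))
  | ExecSeq c1 c2 s1 s2 s3 t1 t2 :
      exec c1 s1 t1 s2 -> exec c2 s2 t2 s3 ->
      exec (Seq c1 c2) s1 (t1 + t2)%N s3
  | ExecIf b c1 c2 s v t s' :
      beval s b = Some v -> exec (if v then c1 else c2) s t s' ->
      exec (If b c1 c2) s (bcost b + t)%N s'
  | ExecWhileEnd b c s :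
      beval s b = Some false -> exec (While b c) s (bcost b) s
  | ExecWhileStep b c s1 s2 s3 t1 t2 :
      beval s1 b = Some true -> exec c s1 t1 s2 ->
      exec (While b c) s2 t2 s3 ->
      exec (While b c) s1 (bcost b + t1 + t2)%N s3.

End Semantics.

Section Input.
Variables (R : realType) (U W : finType).

(* The k-th entry of the #|U| x #|W| matrix f stored row by row, the agents of
   each side being numbered by enum_rank; x0 beyond the matrix. *)
Definition row_major (X : Type) (x0 : X) (f : U * W -> X) (k : nat) : X :=
  if [pick e : U * W | (enum_rank e.1 * #|W| + enum_rank e.2 == k)%N] is Some e
  then f e else x0.

Variables (E M : {set U * W}) (p gamma : U + W -> U * W -> R).

Definition on_edges (f : U * W -> R) (e : U * W) : R :=
  if e \in E then f e else 0.

Definition input : state R := State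
  (fun a k => match a with
    | 0 => if k == 0%N then #|U|%:Z else 0
    | 1 => if k == 0%N then #|W|%:Z else 0
    | 2 => row_major 0 (fun e => (e \in E : nat)%:Z) k
    | 3 => row_major 0 (fun e => (e \in M : nat)%:Z) k
    | _ => 0
    end)
  (fun a => match a with
    | 0 => row_major 0 (on_edges (fun e => p (inl e.1) e))
    | 1 => row_major 0 (on_edges (fun e => p (inr e.2) e))
    | 2 => row_major 0 (on_edges (fun e => gamma (inl e.1) e))
    | 3 => row_major 0 (on_edges (fun e => gamma (inr e.2) e))
    | _ => fun=> 0
    end).

End Input.

(* The answer is left in cell 0 of integer array 4. *)
Definition accepts (R : realType) (s : state R) : Prop := imem s 4 0 = 1.

Definition bigO (f g : nat -> nat) : Prop :=
  exists C n0 : nat, forall n : nat, (n0 <= n)%N -> (f n <= C * g n)%N.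

(* Main.v *)
(* M is gamma-popular iff it is a minimum-cost matching, where an edge outside M
   costs the votes of its two ends, an edge of M costs 0, and each agent matched
   by M but left alone costs 1.  By LP duality this holds iff there are agent
   potentials that are opposite along the edges of M, vanish on unmatched agents,
   are at most 1 (hence at least -1), and whose sum over the ends of any edge is
   at most the vote of that edge.  The dual is obtained without LP theory, from
   shortest paths in the residual graph of an assignment problem: a negative
   simple cycle would yield a matching that beats M.
   For the running time, the largest integral potentials are approached from
   above: start with 1 on every matched agent of U and scan all the edges
   repeatedly, lowering the U-end of any violated edge by 1.  No potential drops
   below -1, so either one of 2|U| + 1 scans of |U| |W| edges finds no violation,
   or there are no such potentials. *)

Require Import Defs.
From mathcomp Require Import all_boot all_order all_algebra.
From mathcomp Require Import reals constructive_ereal zify ring.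

Set Implicit Arguments.
Unset Strict Implicit.
Unset Printing Implicit Defensive.

Import Order.TTheory GRing.Theory Num.Theory.
Local Open Scope ring_scope.

(** * Potentials and negative cycles *)

Section Potentials.
Variables (A : finType) (arc : rel A) (d : A -> A -> int).

Fixpoint walk_weight (a : A) (q : seq A) : int :=
  if q is b :: q' then d a b + walk_weight b q' else 0.

Lemma walk_weight_cat a q1 q2 :
  walk_weight a (q1 ++ q2) = walk_weight a q1 + walk_weight (last a q1) q2.
Proof. by elim: q1 a => [|b q1 IH] a /=; rewrite ?add0r // IH addrA. Qed.

(** The closing vertex [b] is kept apart from the head [a], which changes along the induction;
    [b := a] gives a closed walk. *)
Lemma sum_next_at b a q : uniq (a :: q) ->
  \sum_(x <- a :: q) d x (next_at x b a q) = walk_weight a (rcons q b).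
Proof.
elim: q a => [|a' q IH] a Uq; first by rewrite big_seq1 /= eqxx addr0.
rewrite big_cons /= eqxx -IH; last by case/andP: Uq.
congr (_ + _); apply: eq_big_seq => x xq.
by case: eqP => // xa; move: Uq; rewrite /= -xa xq.
Qed.

(** [next c] fixes everything outside [c], and loops weigh nothing; a cycle thus acts as a
    permutation of all of [A]. *)
Lemma sum_next c : (forall a, d a a = 0) -> uniq c ->
  \sum_x d x (next c x) = \sum_(x <- c) d x (next c x).
Proof.
move=> d0 Uc; rewrite [RHS]big_uniq //= [LHS](bigID (mem c)) /= addrC big1 ?add0r//.
by move=> x xc; rewrite next_nth (negPf xc).
Qed.

(** The potential of [a] is the least weight of a simple walk that starts at [a] and ends anywhere.
    Prepending an arc to a best walk keeps it simple or closes a cycle, and cutting off that cycle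
    does not increase the weight. *)
Lemma potential_exists :
    (forall c, uniq c -> cycle arc c -> 0 <= \sum_(x <- c) d x (next c x)) ->
  exists y : A -> int, forall a b, arc a b -> y a <= y b + d a b.
Proof.
move=> nneg.
(* Length at most [#|A|] makes the candidates a finite type and loses no simple walk; the empty walk
   is always a candidate. *)
pose good a (q : {bseq #|A| of A}) := path arc a q && uniq (a :: q).
pose best a := [arg min_(q < [bseq] | good a q) walk_weight a q]%O.
have bestP a : good a (best a) /\
    forall q : seq A, path arc a q -> uniq (a :: q) ->
      walk_weight a (best a) <= walk_weight a q.
  rewrite /best; case: Order.TotalTheory.arg_minP => // q gq minq; split=> // r pr Ur.
  have szr : (size r <= #|A|)%N.
    by apply: (leq_trans _ (max_card (mem (a :: r)))); rewrite (card_uniqP Ur) /=.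
  by apply: (minq (Bseq szr)); rewrite /good pr.
exists (fun a => walk_weight a (best a)) => a b ab.
have [/andP[pb Ub] _] := bestP b; have [_ min_a] := bestP a.
set q := best b : seq A in pb Ub *.
have [abq|abq] := boolP (a \in b :: q); last first.
  rewrite addrC; apply: (min_a (b :: q)); first by rewrite /= ab.
  by rewrite cons_uniq abq.
have [eab|nab] := eqVneq a b.
  subst b; rewrite lerDl.
  by have := nneg [:: a] isT; rewrite /= ab => /(_ isT); rewrite big_seq1 /= eqxx.
have aq : a \in q by move: abq; rewrite inE (negPf nab).
(* The walk returns to [a]: the cycle [a, b, q1] has nonnegative weight, and [q2] remains as a
   simple walk from [a]. *)
case/splitPr: aq pb Ub => q1 q2; rewrite cat_path /= => /and3P[p1 p1a p2].
rewrite -[_ && _]/(uniq ((b :: q1) ++ a :: q2)) cat_uniq => /and3P[Ub1 Ub12 Ua2].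
have Uab : uniq (a :: b :: q1).
  by rewrite cons_uniq Ub1 andbT; move: Ub12; rewrite /= negb_or => /andP[].
have := nneg (a :: b :: q1) Uab; rewrite /= ab rcons_path p1 p1a => /(_ isT).
rewrite (@sum_next_at a a (b :: q1)) //= -cats1 walk_weight_cat /= addr0 => cyc.
rewrite walk_weight_cat /=.
have := min_a q2 p2 Ua2.
by move: (walk_weight _ _) => *; lia.
Qed.

End Potentials.

(** * Witnesses of popularity *)

Section Certificates.
Variables (R : realType) (U W : finType).
Variables (p gamma : U + W -> U * W -> R) (E M : {set U * W}).

(** The vote of [v] when M(v) is replaced by a different edge [e]. An unmatched agent favours every
    edge, its valuation being -oo. *)
Definition approval (v : U + W) (e : U * W) : int :=
  if edge_of M v is Some f then
    if p v f + gamma v e <= p v e then -1 else 1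
  else -1.

Definition edge_approval (e : U * W) : int :=
  approval (inl e.1) e + approval (inr e.2) e.

(* Witnesses of popularity are potentials that are opposite at the two ends of
   each edge of M, hence functions of the edge M(v), the agent v in U having
   potential [xi (M v)] and the agent v in W having potential [- xi (M v)]. *)
Definition tension (xi : option (U * W) -> int) (e : U * W) : int :=
  xi (edge_of M (inl e.1)) - xi (edge_of M (inr e.2)).

Definition witness (xi : option (U * W) -> int) : Prop :=
  [/\ xi None = 0, forall o, -1 <= xi o <= 1 &
      forall e, e \in E -> tension xi e <= edge_approval e].

Lemma edge_of_eq (N : {set U * W}) v e : is_matching E N ->
  (edge_of N v == Some e) = (e \in N) && incident v e.
Proof.
move=> [sNE mN]; rewrite /edge_of; case: pickP => [f /andP[fN vf]|none].
  apply/eqP/andP => [[<-] //|[eN ve]]; congr Some.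
  by apply: (card_le1_eqP (mN v)); rewrite !inE ?fN ?eN ?vf ?ve (subsetP sNE).
by apply/esym/negbTE/negP => h; have := none e; rewrite h.
Qed.

Lemma edge_of_Some (N : {set U * W}) v e :
  edge_of N v = Some e -> e \in N /\ incident v e.
Proof. by rewrite /edge_of; case: pickP => // f /andP[fN vf] [<-]. Qed.

Lemma edge_of_l (N : {set U * W}) e : is_matching E N -> e \in N ->
  edge_of N (inl e.1) = Some e.
Proof. by move=> mN eN; apply/eqP; rewrite edge_of_eq // eN /=. Qed.

Lemma edge_of_r (N : {set U * W}) e : is_matching E N -> e \in N ->
  edge_of N (inr e.2) = Some e.
Proof. by move=> mN eN; apply/eqP; rewrite edge_of_eq // eN /=. Qed.

(** Each matched agent is counted through its only edge of [N]; exchanging the two sums then groups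
    the ends of each edge. *)
Lemma sum_agents (N : {set U * W}) (f : U + W -> int) : is_matching E N ->
  \sum_v f v = \sum_(v | edge_of N v == None) f v
               + \sum_(e in N) (f (inl e.1) + f (inr e.2)).
Proof.
move=> mN; rewrite (bigID (fun v => edge_of N v == None)) /=; congr (_ + _).
transitivity (\sum_v \sum_(e in N | incident v e) f v).
  rewrite big_mkcond; apply: eq_bigr => v _ /=.
  case Nv: (edge_of N v) => [e|] /=.
    rewrite (big_pred1 e) // => e'.
    by rewrite -edge_of_eq // Nv eq_sym.
  rewrite big_pred0 // => e.
  by rewrite -edge_of_eq // Nv.
rewrite (exchange_big_dep (mem N)) /=; last by move=> v e _ /andP[].
apply: eq_bigr => e eN; rewrite big_sumType /=.
by congr (_ + _); apply: big_pred1 => v; rewrite /= eN /= eq_sym.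
Qed.

Lemma vote_changed (N : {set U * W}) v e :
  edge_of N v = Some e -> edge_of M v != Some e ->
  vote p gamma M N v = approval v e.
Proof.
move=> Nv Mv; rewrite /vote /approval Nv (negPf Mv) /=.
by case: (edge_of M v) => [f|] /=; rewrite ?addNye ?leNye // -EFinD lee_fin.
Qed.

Lemma vote_alone (N : {set U * W}) v :
  edge_of N v = None -> vote p gamma M N v = (edge_of M v != None)%:Z.
Proof.
by move=> Nv; rewrite /vote Nv; case: (edge_of M v).
Qed.

Lemma vote_kept (N : {set U * W}) v :
  edge_of N v = edge_of M v -> vote p gamma M N v = 0.
Proof. by move=> Nv; rewrite /vote Nv eqxx. Qed.

Hypothesis matchM : is_matching E M.

Definition agent_potential (xi : option (U * W) -> int) (v : U + W) : int :=
  if v is inl _ then xi (edge_of M v) else - xi (edge_of M v).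

(** Weak duality: the agent potentials sum to 0 because they cancel along [M], and along [N] they
    are bounded by the votes, both on each edge and on each agent left alone. *)
Lemma witness_popular xi : witness xi -> popular p gamma E M.
Proof.
case=> xi0 xi1 xiE N mN.
have xi_sum : \sum_v agent_potential xi v = 0.
  rewrite (sum_agents _ matchM) big1 ?add0r; last first.
    by move=> [u|w] /eqP h; rewrite /agent_potential h xi0 ?oppr0.
  by rewrite big1 // => e eM; rewrite /= edge_of_l // edge_of_r // subrr.
suff : \sum_v agent_potential xi v <= \sum_v vote p gamma M N v.
  by rewrite xi_sum.
rewrite !(sum_agents _ mN); apply: lerD; apply: ler_sum.
  move=> v /eqP Nv; rewrite vote_alone // /agent_potential.
  have := xi1 (edge_of M v); case: v {Nv} => v.
    by case: (edge_of M _) => [e|] /=; rewrite ?xi0; lia.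
  by case: (edge_of M _) => [e|] /=; rewrite ?xi0; lia.
move=> e eN; have eE : e \in E by case: mN => /subsetP/(_ e eN).
have [eM|eM] := boolP (e \in M).
  rewrite !vote_kept; try by rewrite ?edge_of_l ?edge_of_r.
  by rewrite /= edge_of_l // edge_of_r // subrr.
rewrite !(@vote_changed _ _ e) ?edge_of_eq ?edge_of_l ?edge_of_r ?(negPf eM) //.
by have := xiE e eE.
Qed.

(* Minimum-weight matching as an assignment problem: each agent v gets a copy v'
   on the opposite side, v may be matched to v' at the cost of staying alone,
   and all pairs of copies are free.  An agent of [U + W] stands for u or w' on
   the left-hand side, and for w or u' on the right-hand side; [mate] is then
   the perfect matching that extends M. *)
Definition mate (v : U + W) : U + W :=
  match v, edge_of M v with
  | inl _, Some e => inr e.2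
  | inr _, Some e => inl e.1
  | _, None => v
  end.

Definition assignable (a b : U + W) : bool :=
  match a, b with
  | inl u, inl u' => u == u'
  | inl u, inr w => (u, w) \in E
  | inr _, inl _ => true
  | inr w, inr w' => w == w'
  end.

(** Keeping an edge of [M] changes no vote, hence the 0. In the last case an assignable pair has
    [a = b], so the cost is the vote of an agent left alone. *)
Definition assignment_cost (a b : U + W) : int :=
  match a, b with
  | inl u, inr w => if (u, w) \in M then 0 else edge_approval (u, w)
  | inr _, inl _ => 0
  | _, _ => (edge_of M a != None)%:Z
  end.

Lemma mateK : involutive mate.
Proof.
move=> [u|w]; rewrite {2}/mate.
  case Mu: (edge_of M (inl u)) => [e|]; last by rewrite /mate Mu.
  have [eM /eqP <-] := edge_of_Some Mu.
  by rewrite /mate edge_of_r.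
case Mw: (edge_of M (inr w)) => [e|]; last by rewrite /mate Mw.
have [eM /eqP <-] := edge_of_Some Mw.
by rewrite /mate edge_of_l.
Qed.

Lemma assignable_mate a : assignable a (mate a).
Proof.
case: a => [u|w]; rewrite /mate.
  case Mu: (edge_of M (inl u)) => [e|] //=.
  have [eM /eqP <-] := edge_of_Some Mu.
  by rewrite -surjective_pairing; case: matchM => /subsetP/(_ e eM).
by case Mw: (edge_of M (inr w)) => [e|] /=.
Qed.

Lemma assignment_cost_mate a : assignment_cost a (mate a) = 0.
Proof.
case: a => [u|w]; rewrite /mate.
  case Mu: (edge_of M (inl u)) => [e|] /=; last by rewrite Mu.
  have [eM /eqP <-] := edge_of_Some Mu.
  by rewrite -surjective_pairing eM.
by case Mw: (edge_of M (inr w)) => [e|] /=; rewrite ?Mw.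
Qed.

(** The pairs in [E] selected by [s] form a matching [N], in which the agents fixed by [s] are
    alone; the cost of [s] equals the total vote between [M] and [N]. *)
Lemma popular_assignment (s : U + W -> U + W) : popular p gamma E M ->
  injective s -> (forall a, assignable a (s a)) ->
  0 <= \sum_a assignment_cost a (s a).
Proof.
move=> popM s_inj s_ok.
pose N := [set e in E | s (inl e.1) == inr e.2].
have mN : is_matching E N.
  split=> [|v]; first by apply/subsetP => e; rewrite inE => /andP[].
  apply/card_le1_eqP => -[u1 w1] [u2 w2].
  rewrite !inE /= => /and3P[/andP[_ /eqP s1] _ i1] /and3P[/andP[_ /eqP s2] _ i2].
  case: v i1 i2 => v /= /eqP h1 /eqP h2; subst.
    by move: s2; rewrite s1 => -[->].
  by have [->] := s_inj _ _ (etrans s1 (esym s2)).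
have Nmem u w : s (inl u) = inr w -> (u, w) \in N.
  by move=> su; rewrite inE /= su eqxx andbT; have := s_ok (inl u); rewrite su.
have Nalone v : s v = v -> edge_of N v = None.
  move=> sv; case Nv: (edge_of N v) => [[u w]|] //.
  have [] := edge_of_Some Nv; rewrite inE /= => /andP[_ /eqP su].
  case: v sv {Nv} => v sv /= /eqP h; subst; first by rewrite sv in su.
  by have := s_inj _ _ (etrans su (esym sv)).
apply: (le_trans (popM N mN)).
(* The vote of an agent of [W] is charged to its preimage under [s], so that both sums agree term by
   term. *)
pose voteW v := if v is inr _ then vote p gamma M N v else 0.
have -> : \sum_v vote p gamma M N v
    = \sum_a ((if a is inl _ then vote p gamma M N a else 0) + voteW (s a)).
  rewrite big_split -[X in _ = _ + X](reindex_inj s_inj (P := predT)) /=.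
  by rewrite -big_split; apply: eq_bigr => -[u|w] _ /=; rewrite ?addr0 ?add0r.
rewrite le_eqVlt; apply/orP; left; apply/eqP/eq_bigr => -[u|w] _.
  have := s_ok (inl u); case su: (s (inl u)) => [u'|w] /=.
    move/eqP=> uu; subst u'; rewrite addr0 vote_alone //; exact: Nalone.
  move=> uwE; have uwN := Nmem _ _ su.
  have Nu := edge_of_l mN uwN; have Nw := edge_of_r mN uwN.
  rewrite /= in Nu Nw.
  case: ifPn => uwM.
    by rewrite !vote_kept ?Nu ?Nw ?(edge_of_l matchM uwM) ?(edge_of_r matchM uwM).
  by rewrite !(@vote_changed _ _ (u, w)) ?edge_of_eq ?(negPf uwM).
have := s_ok (inr w); case sw: (s (inr w)) => [u'|w'] //=.
by move/eqP=> ww; subst w'; rewrite add0r vote_alone //; exact: Nalone.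
Qed.

Lemma approval_matched v e : 0 < gamma v e -> edge_of M v = Some e ->
  approval v e = 1.
Proof. by move=> g0 Mv; rewrite /approval Mv gerDl leNgt g0. Qed.

(** Strong duality: a cycle of the residual graph turns [mate] into another assignment, whose cost
    popularity makes nonnegative. The resulting potentials [y] give a witness through the difference
    between an agent and its mate. *)
Lemma popular_witness : (forall v e, e \in edges_at E v -> 0 < gamma v e) ->
  popular p gamma E M -> exists xi, witness xi.
Proof.
move=> gamma_gt0 popM.
pose d a b := assignment_cost a (mate b).
have [|y yP] := @potential_exists (U + W)%type (fun a b => assignable a (mate b)) d.
  move=> c Uc cyc_c; rewrite -(@sum_next _ d) //; last exact: assignment_cost_mate.
  (* Agents on [c] take the mate of their successor; the others keep their own. *)
  apply: (popular_assignment (s := mate \o next c)) => // [|a].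
    exact: inj_comp (can_inj mateK) (can_inj (prev_next Uc)).
  have [ac|ac] := boolP (a \in c); first exact: (next_cycle cyc_c).
  by rewrite /= next_nth (negPf ac) assignable_mate.
have {}yP a b : assignable a b -> y a <= y (mate b) + assignment_cost a b.
  by move=> ab; have := yP a (mate b); rewrite /d mateK; apply.
pose z v := y v - y (mate v).
(* Staying alone costs at most 1. Applied to [mate v], the same bound later yields [-1 <= z v]. *)
have z_le1 v : z v <= 1.
  have : assignable v v by case: v => v /=.
  move=> /yP; rewrite /z; case: v => v /=; case: eqP => _ /=; lia.
have z_mate v : z (mate v) = - z v by rewrite /z mateK opprB.
pose xi o := if o is Some e then if e \in M then z (inl e.1) else 0 else 0.
have xi_l u : xi (edge_of M (inl u)) = z (inl u).
  case Mu: (edge_of M (inl u)) => [e|] /=; last by rewrite /z /mate Mu subrr.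
  by have [-> /eqP <-] := edge_of_Some Mu.
have xi_r w : xi (edge_of M (inr w)) = - z (inr w).
  case Mw: (edge_of M (inr w)) => [e|] /=; last by rewrite /z /mate Mw subrr.
  have [eM _] := edge_of_Some Mw; rewrite eM -z_mate.
  by rewrite /mate Mw.
exists xi; split=> // [[e|]|[u w] uwE] //=.
  case: ifP => // _; have := z_le1 (mate (inl e.1)); have := z_le1 (inl e.1).
  by rewrite z_mate => *; lia.
rewrite /tension /= xi_l xi_r.
(* The free pair of copies supplies the second inequality; together they bound
   [z (inl u) + z (inr w)]. *)
have := yP (inl u) (inr w) uwE; have := yP (inr w) (inl u) isT.
rewrite /z /=; case: ifPn => [uwM|_]; last by lia.
(* On an edge of [M] the cost is 0, and positive thresholds make both approvals 1, so the bound 0 is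
   enough. *)
suff -> : edge_approval (u, w) = 2 by lia.
rewrite /edge_approval !approval_matched //=.
- by apply: gamma_gt0; rewrite inE uwE /=.
- exact: (edge_of_r matchM uwM).
- by apply: gamma_gt0; rewrite inE uwE /=.
- exact: (edge_of_l matchM uwM).
Qed.
End Certificates.

(** * Programs *)

Notation memory := (nat -> nat -> int).

Notation cell m a k := (m a%N k%N) (only parsing).

Definition var (a : nat) : iexp := IGet a (IConst 0).

Definition set_var (a : nat) (e : iexp) : com := ISet a (IConst 0) e.

Definition for_loop (a : nat) (bound : iexp) (body : com) : com :=
  Seq (set_var a (IConst 0))
    (While (BNot (ILe bound (var a)))
      (Seq body (set_var a (IAdd (var a) (IConst 1))))).

(** * Timed total-correctness rules for programs *)

Section Runs.
Variables (R : realType) (B : nat) (r : nat -> nat -> R).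

(** The real memory [r] is a fixed parameter: the program reads it but never writes to it. *)
Definition runs (c : com) (m : memory) (t : nat) (Q : memory -> Prop) : Prop :=
  exists t' m', [/\ exec B c (State m r) t' (State m' r), (t' <= t)%N & Q m'].

Lemma runs_weaken c m (t t' : nat) (Q Q' : memory -> Prop) : (t <= t')%N ->
  (forall m', Q m' -> Q' m') -> runs c m t Q -> runs c m t' Q'.
Proof.
move=> tt' QQ' [u [m' [ex ut Qm]]]; exists u, m'; split=> //; last exact: QQ'.
exact: leq_trans tt'.
Qed.

Lemma runs_seq c1 c2 m t1 t2 Q :
  runs c1 m t1 (fun m' => runs c2 m' t2 Q) -> runs (Seq c1 c2) m (t1 + t2) Q.
Proof.
move=> [u1 [m1 [ex1 ut1 [u2 [m2 [ex2 ut2 Qm]]]]]].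
by exists (u1 + u2)%N, m2; split; [exact: ExecSeq ex1 ex2 | exact: leq_add |].
Qed.

Lemma runs_skip m (Q : memory -> Prop) : Q m -> runs Skip m 1 Q.
Proof. by move=> Qm; exists 1%N, m; split=> //; exact: ExecSkip. Qed.

Lemma runs_set a i e m k z (Q : memory -> Prop) :
  ieval B (State m r) i = Some (Posz k) -> ieval B (State m r) e = Some z ->
  Q (update m a k z) -> runs (ISet a i e) m (icost i + icost e).+1 Q.
Proof.
move=> ik ez Qm; exists (icost i + icost e).+1, (update m a k z); split=> //.
by apply: (@ExecISet R B (State m r)) => //; rewrite ik.
Qed.

Lemma runs_if b c1 c2 m t1 t2 v Q : beval B (State m r) b = Some v ->
  (v -> runs c1 m t1 Q) -> (~~ v -> runs c2 m t2 Q) ->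
  runs (If b c1 c2) m (bcost b + maxn t1 t2) Q.
Proof.
case: v => bv run1 run2.
  have [u [m' [ex ut Qm]]] := run1 isT.
  exists (bcost b + u)%N, m'; split=> //; first exact: ExecIf bv ex.
  by rewrite leq_add2l leq_max ut.
have [u [m' [ex ut Qm]]] := run2 isT.
exists (bcost b + u)%N, m'; split=> //; first exact: ExecIf bv ex.
by rewrite leq_add2l leq_max ut orbT.
Qed.

Section Evaluation.
Variable s : state R.

Lemma ieval_const z : (absz z <= B)%N -> ieval B s (IConst z) = Some z.
Proof. by move=> zB; rewrite /= /word zB. Qed.

Lemma ieval_get a i k :
  ieval B s i = Some (Posz k) -> ieval B s (IGet a i) = Some (imem s a k).
Proof. by move=> /= ->. Qed.

Lemma ieval_var a : ieval B s (var a) = Some (imem s a 0).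
Proof. exact/ieval_get/ieval_const. Qed.

Lemma ieval_add e1 e2 x y : ieval B s e1 = Some x -> ieval B s e2 = Some y ->
  (absz (x + y)%R <= B)%N -> ieval B s (IAdd e1 e2) = Some (x + y).
Proof. by move=> /= -> -> xyB; rewrite /= /word xyB. Qed.

Lemma ieval_sub e1 e2 x y : ieval B s e1 = Some x -> ieval B s e2 = Some y ->
  (absz (x - y)%R <= B)%N -> ieval B s (ISub e1 e2) = Some (x - y).
Proof. by move=> /= -> -> xyB; rewrite /= /word xyB. Qed.

Lemma ieval_mul e1 e2 x y : ieval B s e1 = Some x -> ieval B s e2 = Some y ->
  (absz (x * y)%R <= B)%N -> ieval B s (IMul e1 e2) = Some (x * y).
Proof. by move=> /= -> -> xyB; rewrite /= /word xyB. Qed.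

Lemma reval_get a i k :
  ieval B s i = Some (Posz k) -> reval B s (RGet a i) = Some (rmem s a k).
Proof. by move=> /= ->. Qed.

Lemma beval_ile e1 e2 x y : ieval B s e1 = Some x -> ieval B s e2 = Some y ->
  beval B s (ILe e1 e2) = Some (x <= y).
Proof. by move=> /= -> ->. Qed.

End Evaluation.

Lemma runs_for a bound body (N t : nat) (Inv : nat -> memory -> Prop) m :
    (N < B)%N ->
    (forall k m z, Inv k m -> Inv k (update m a 0 z)) ->
    (forall k m, Inv k m -> ieval B (State m r) bound = Some (Posz N)) ->
    (forall k m, (k < N)%N -> Inv k m -> cell m a 0 = k ->
       runs body m t (fun m' => cell m' a 0 = k /\ Inv k.+1 m')) ->
    Inv 0 m ->
  runs (for_loop a bound body) m (N.+1 * (t + icost bound + 10)) (Inv N).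
Proof.
move=> NB Inv_update boundP bodyP Inv0.
(* The 10 covers 4 for the guard besides the bound and 6 for the increment. The 3 subtracted pays
   for the initialisation, out of the slack left by the final guard. *)
suff loop k m0 : (k <= N)%N -> Inv k m0 -> cell m0 a 0 = k ->
    runs (While (BNot (ILe bound (var a)))
           (Seq body (set_var a (IAdd (var a) (IConst 1))))) m0
      ((N - k).+1 * (t + icost bound + 10) - 3) (Inv N).
  apply: (@runs_weaken _ _ (3 + (N.+1 * (t + icost bound + 10) - 3)) _ (Inv N)) => //.
    by rewrite mulSn; lia.
  apply: runs_seq; apply: (@runs_set a _ _ m 0 0); [by []|by []|].
  rewrite -[N in N.+1]subn0; apply: loop => //; first exact: Inv_update.
  by rewrite /update !eqxx.
move=> kN; have [d dE] : exists d, (d = N - k)%N by exists (N - k)%N.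
elim: d k m0 kN dE => [|d IH] k m0 kN dE Invk ak.
  have eqk : k = N by lia.
  subst k; exists (icost bound + 4)%N, m0; split=> //; last by lia.
  have -> : (icost bound + 4)%N = bcost (BNot (ILe bound (var a))) by rewrite /=; lia.
  apply: ExecWhileEnd; rewrite /=.
  by rewrite (boundP _ _ Invk) /= ak lexx.
have ltkN : (k < N)%N by lia.
have [t1 [m1 [ex1 le1 [ak1 Inv1]]]] := bodyP k m0 ltkN Invk ak.
have [||||t2 [m2 [ex2 le2 Inv2]]] := IH k.+1 (update m1 a 0 k.+1) => //.
- lia.
- exact: Inv_update.
- by rewrite /update !eqxx.
exists (bcost (BNot (ILe bound (var a))) + (t1 + 6) + t2)%N, m2; split=> //.
- apply: ExecWhileStep ex2.
    by rewrite /= (boundP _ _ Invk) /= ak lez_nat -ltnNge ltkN.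
  apply: ExecSeq ex1 _.
  apply: (@ExecISet R B (State m1 r)) => //.
  have -> : Posz k.+1 = Posz k + 1 by lia.
  apply: ieval_add; [by rewrite ieval_var /= ak1|apply: ieval_const|]; lia.
- rewrite /=; have -> : (N - k = (N - k.+1).+1)%N by lia.
  by rewrite mulSn; lia.
Qed.

End Runs.

(** * Numbering of the pairs of agents *)

Section Edges.
Variables (U W : finType).

Definition edge_index (e : U * W) : nat :=
  (enum_rank e.1 * #|W| + enum_rank e.2)%N.

Lemma edge_index_lt e : (edge_index e < #|U| * #|W|)%N.
Proof.
have := ltn_ord (enum_rank e.1); have := ltn_ord (enum_rank e.2).
rewrite /edge_index => jW iU.
apply: (@leq_trans ((enum_rank e.1).+1 * #|W|)); last by rewrite leq_mul2r iU orbT.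
by rewrite mulSn addnC ltn_add2r.
Qed.

(** Row and column are recovered as quotient and remainder by [#|W|]. *)
Lemma edge_index_inj : injective edge_index.
Proof.
move=> [u1 w1] [u2 w2]; rewrite /edge_index /= => eq12.
have W_gt0 : (0 < #|W|)%N by apply/card_gt0P; exists w1.
have := congr1 (fun k => k %/ #|W|)%N eq12; have := congr1 (fun k => k %% #|W|)%N eq12.
rewrite !modnMDl !modn_small ?ltn_ord // !divnMDl // !divn_small ?ltn_ord // !addn0.
by move=> /val_inj/enum_rank_inj -> /val_inj/enum_rank_inj ->.
Qed.

Lemma edge_index_ltS e e' :
  (edge_index e' < (edge_index e).+1)%N = (e' == e) || (edge_index e' < edge_index e)%N.
Proof. by rewrite ltnS leq_eqVlt (inj_eq edge_index_inj). Qed.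

Lemma row_major_index (X : Type) (x0 : X) f e : row_major x0 f (edge_index e) = f e.
Proof.
rewrite /row_major; case: pickP => [e' /eqP/edge_index_inj -> //|/(_ e)].
by rewrite /edge_index eqxx.
Qed.

End Edges.

Definition edge_loop (body : com) : com :=
  for_loop 9 (var 0) (for_loop 10 (var 1) body).

Definition index_exp : iexp := IAdd (IMul (var 9) (var 1)) (var 10).

Section EdgeLoop.
Variables (R : realType) (U W : finType) (B : nat) (r : nat -> nat -> R).
Hypotheses (UB : (#|U| < B)%N) (WB : (#|W| < B)%N) (UWB : (#|U| * #|W| < B)%N).

Record loop_at (e : U * W) (m : memory) : Prop := LoopAt {
  loop_W : cell m 1 0 = #|W|;
  loop_l : cell m 9 0 = enum_rank e.1;
  loop_r : cell m 10 0 = enum_rank e.2 }.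

(** The nested loops visit the pairs in the order of [edge_index], so one invariant indexed by
    position serves both. Each 12 is the loop overhead 10 plus 2 for reading the bound. *)
Lemma runs_edge_loop body (t : nat) (Inv : nat -> memory -> Prop) m :
    (forall k m a z, (a == 9)%N || (a == 10)%N -> Inv k m -> Inv k (update m a 0 z)) ->
    (forall k m, Inv k m -> cell m 0 0 = #|U| /\ cell m 1 0 = #|W|) ->
    (forall e m, loop_at e m -> Inv (edge_index e) m ->
       runs B r body m t
         (fun m' => [/\ cell m' 9 0 = cell m 9 0, cell m' 10 0 = cell m 10 0 &
                        Inv (edge_index e).+1 m'])) ->
    Inv 0 m ->
  runs B r (edge_loop body) m (#|U|.+1 * (#|W|.+1 * (t + 12) + 12))
    (Inv (#|U| * #|W|)%N).
Proof.
move=> Inv_update Inv_card bodyP Inv0.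
have varE m0 a k : cell m0 a 0 = Posz k -> ieval B (State m0 r) (var a) = Some (Posz k).
  by move=> mk; rewrite ieval_var /= mk.
have -> : (#|U|.+1 * (#|W|.+1 * (t + 12) + 12)
    = #|U|.+1 * (#|W|.+1 * (t + icost (var 1) + 10) + icost (var 0) + 10))%N.
  by rewrite /= -!addnA.
apply: (runs_for (Inv := fun i m => Inv (i * #|W|)%N m)) => //.
- by move=> k m0 z; apply: Inv_update.
- by move=> k m0 /Inv_card[m0U _]; apply: varE.
move=> i m0 iU Invi m0i.
apply: (@runs_weaken _ _ _ _ _ _ _
  (fun m' => cell m' 9 0 = i /\ Inv (i * #|W| + #|W|)%N m')) (leqnn _) _ _.
  by move=> m' [m'i Invm']; split=> //; rewrite mulSn addnC.
apply: (runs_for (Inv := fun j m' => cell m' 9 0 = i /\ Inv (i * #|W| + j)%N m')) => //.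
- by move=> k m1 z [m1i Inv1]; split=> //; exact: Inv_update.
- by move=> k m1 [_ /Inv_card[_ m1W]]; apply: varE.
- move=> j m1 jW [m1i Inv1] m1j.
  pose e : U * W := (enum_val (Ordinal iU), enum_val (Ordinal jW)).
  have eE : edge_index e = (i * #|W| + j)%N by rewrite /edge_index /= !enum_valK.
  have at_e : loop_at e m1.
    have [_ m1W] := Inv_card _ _ Inv1.
    by split; rewrite ?m1i ?m1j //= enum_valK.
  apply: runs_weaken (leqnn _) _ (bodyP e m1 at_e _); last by rewrite eE.
  by move=> m2; rewrite eE addnS m1i m1j => -[].
- by rewrite addn0.
Qed.

Lemma ieval_index e m : loop_at e m ->
  ieval B (State m r) index_exp = Some (Posz (edge_index e)).
Proof.
case=> mW ml mr; have eB : (edge_index e <= B)%N.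
  exact/ltnW/(ltn_trans (edge_index_lt e)).
rewrite /edge_index PoszD PoszM; apply: ieval_add; last exact: eB.
  apply: ieval_mul; rewrite ?ieval_var /= ?ml ?mW //.
  exact: leq_trans (leq_addr _ _) eB.
by rewrite ieval_var /= mr.
Qed.

End EdgeLoop.

(** * The decision procedure *)

Section Relaxation.
Variables (R : realType) (U W : finType).
Variables (p gamma : U + W -> U * W -> R) (E M : {set U * W}).

Definition no_witness : Prop := forall zeta, ~ witness p gamma E M zeta.

(** Descending potentials that stay above every witness cannot overshoot the largest one. *)
Definition above_witnesses (xi : option (U * W) -> int) : Prop :=
  [/\ xi None = 0, forall o, -1 <= xi o <= 1 &
      forall zeta v, witness p gamma E M zeta ->
        zeta (edge_of M v) <= xi (edge_of M v)].

(** Termination measure: it lies between 0 and [2 * #|U|], and each lowering decreases it. *)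
Definition mass (xi : option (U * W) -> int) : int :=
  \sum_(u : U) (xi (edge_of M (inl u)) + 1).

(* Invariants after q scans, resp. after the first k edges of the next one; b is
   the answer flag, which is cleared by any violation found in the last scan.  A
   scan that clears it decreases [mass], unless there is no witness. *)
Definition pass_inv (q : nat) xi (b : bool) : Prop :=
  above_witnesses xi /\
  if b then witness p gamma E M xi
  else no_witness \/ mass xi + q%:Z <= 2 * #|U|%:Z.

Definition scan_inv (q k : nat) xi (b : bool) : Prop :=
  above_witnesses xi /\
  if b then
    (forall e, e \in E -> (edge_index e < k)%N ->
       tension M xi e <= edge_approval p gamma M e) /\
    [\/ witness p gamma E M xi, no_witness | mass xi + q%:Z <= 2 * #|U|%:Z]
  else no_witness \/ mass xi + q.+1%:Z <= 2 * #|U|%:Z.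

Definition lower (xi : option (U * W) -> int) (o o' : option (U * W)) : int :=
  if o' == o then xi o - 1 else xi o'.

Lemma scan_start q xi b : pass_inv q xi b -> scan_inv q 0 xi true.
Proof. by case=> up; case: b => [wit|[no|le]]; split=> //; split=> //; constructor. Qed.

(** If the flag is still set, all edges were checked against the same potentials, since a lowering
    clears it; these potentials then form a witness. *)
Lemma scan_end q xi b : scan_inv q (#|U| * #|W|) xi b -> pass_inv q.+1 xi b.
Proof.
case=> up; case: b => [[ok _]|h]; split=> //; case: up => xi0 xi1 _; split=> // e eE.
by apply: ok => //; exact: edge_index_lt.
Qed.

Lemma scan_next q e xi (b : bool) :
    (e \in E -> b -> tension M xi e <= edge_approval p gamma M e) ->
  scan_inv q (edge_index e) xi b -> scan_inv q (edge_index e).+1 xi b.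
Proof.
move=> ok [up]; case: b ok => [ok [prev le]|_ h].
  split=> //; split=> // e' + e'k; move: e'k.
  by rewrite edge_index_ltS => /predU1P[-> eE|]; [exact: ok | move=> *; exact: prev].
by split.
Qed.

Lemma mass_ge0 xi : above_witnesses xi -> 0 <= mass xi.
Proof.
case=> _ xi1 _; apply: sumr_ge0 => u _; have := xi1 (edge_of M (inl u)); lia.
Qed.

Lemma mass_le xi : above_witnesses xi -> mass xi <= 2 * #|U|%:Z.
Proof.
case=> _ xi1 _; have -> : 2 * #|U|%:Z = \sum_(u : U) (2 : int).
  by rewrite -natz sumr_const -[RHS]mulr_natr; congr (_ * _%:R); exact: eq_card.
by apply: ler_sum => u _; have := xi1 (edge_of M (inl u)); lia.
Qed.

Lemma mass_lower xi u :
  mass (lower xi (edge_of M (inl u))) <= mass xi - 1.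
Proof.
rewrite /mass (bigD1 u) //= [leRHS](_ : _ = xi (edge_of M (inl u)) - 1 + 1 +
  \sum_(i | i != u) (xi (edge_of M (inl i)) + 1)); last by rewrite (bigD1 u) //=; ring.
apply: lerD; first by rewrite /lower eqxx.
apply: ler_sum => u' _; rewrite /lower; case: eqP => [->|_] //.
by rewrite lerD2r gerBl.
Qed.

(** A witness lies below [xi] at the W-end of [e], so the violated constraint forces it strictly
    below [xi] at the U-end. By integrality lowering by 1 is safe; where it is impossible, there is
    no witness. *)
Lemma scan_violated q k xi b e (o := edge_of M (inl e.1)) : e \in E ->
    edge_approval p gamma M e < tension M xi e ->
    scan_inv q k xi b ->
  scan_inv q (edge_index e).+1
    (if (o != None) && (0 <= xi o) then lower xi o else xi) false.
Proof.
move=> eE viol [up small]; case: (up) => xi0 xi1 xi_up.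
have strict zeta : witness p gamma E M zeta -> zeta o < xi o.
  move=> wz; case: (wz) => _ _ /(_ e eE).
  have := xi_up zeta (inr e.2) wz; move: viol; rewrite /tension -/o.
  by move: (edge_approval _ _ _ _) (xi o) (zeta o) => *; lia.
(* A set flag cannot come with [xi] being a witness, as [e] violates it; a cleared flag gives an
   even stronger bound. *)
have {small}: no_witness \/ mass xi + q%:Z <= 2 * #|U|%:Z.
  case: b small => [[_ [[_ _ wit]|no|le]]|[no|le]]; [|by left|by right|by left|].
    by have := wit e eE; lia.
  by right; lia.
case: ifPn => [/andP[o_neq xi_o] small|].
  split; last first.
    case: small => [no|le]; [by left|right].
    by have := mass_lower xi e.1; rewrite -/o; lia.
  split=> [|o'|zeta v wz].
  - by rewrite /lower eq_sym (negPf o_neq).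
  - by rewrite /lower; case: eqP => _ //; have := xi1 o; lia.
  - rewrite /lower; case: eqP => [->|_]; last exact: xi_up.
    by have := strict _ wz; lia.
(* Either [o] is [None], where both potentials are 0, or [xi o] is already -1, the least value
   allowed. *)
rewrite negb_and negbK => at_min _; split=> //; left=> zeta wz.
have := strict _ wz; case: (wz) => zeta0 zeta1 _.
case/orP: at_min => [/eqP->|xi_o]; first by rewrite zeta0 xi0.
by have := zeta1 o; have := xi1 o; lia.
Qed.

End Relaxation.

(** Meant for loop-free programs only; the value at [While] is a dummy. *)
Fixpoint time_bound (c : com) : nat :=
  match c with
  | Skip => 1
  | ISet _ i e => (icost i + icost e).+1
  | RSet _ i e => (icost i + rcost e).+1
  | Seq c1 c2 => time_bound c1 + time_bound c2
  | If b c1 c2 => bcost b + maxn (time_bound c1) (time_bound c2)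
  | While _ _ => 0
  end.

(* Arrays 5 (indexed by U) and 6 (indexed by W) hold, for each agent v, the
   code of M(v): 0 if v is unmatched, and otherwise the position of its edge in
   the input matrices plus 1.  Array 7 holds the potentials, indexed by code. *)
Definition code_l : iexp := IGet 5 (var 9).
Definition code_r : iexp := IGet 6 (var 10).

Definition init_edge : com :=
  If (ILe (IConst 1) (IGet 3 index_exp))
    (Seq (ISet 5 (var 9) (IAdd index_exp (IConst 1)))
      (Seq (ISet 6 (var 10) (IAdd index_exp (IConst 1)))
        (ISet 7 (IAdd index_exp (IConst 1)) (IConst 1))))
    Skip.

(** [k] is 0 for [U] and 1 for [W]: real arrays [k] and [k.+2] hold the valuations and thresholds of
    that side. A positive code minus 1 is the position of M(v). *)
Definition set_approval (a : nat) (code : iexp) (k : nat) : com :=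
  If (ILe (IConst 1) code)
    (If (RLe (RAdd (RGet k (ISub code (IConst 1))) (RGet k.+2 index_exp))
             (RGet k index_exp))
      (set_var a (IConst (-1)))
      (set_var a (IConst 1)))
    (set_var a (IConst (-1))).

(** Arrays 12 and 13 receive the approvals of the two ends. The potential in array 7 is shared along
    an edge of [M], so lowering it at the U-end also raises the opposite potential of its
    partner. *)
Definition relax_edge : com :=
  If (ILe (IConst 1) (IGet 2 index_exp))
    (Seq (set_approval 12 code_l 0)
      (Seq (set_approval 13 code_r 1)
        (If (ILe (ISub (IGet 7 code_l) (IGet 7 code_r)) (IAdd (var 12) (var 13)))
          Skip
          (Seq (set_var 4 (IConst 0))
            (If (BAnd (ILe (IConst 1) code_l) (ILe (IConst 0) (IGet 7 code_l)))
              (ISet 7 code_l (ISub (IGet 7 code_l) (IConst 1)))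
              Skip)))))
    Skip.

(** The flag is reset before every scan, so the answer is that of the last one. *)
Definition decide_popular : com :=
  Seq (edge_loop init_edge)
    (for_loop 11 (IAdd (IAdd (var 0) (var 0)) (IConst 1))
      (Seq (set_var 4 (IConst 1)) (edge_loop relax_edge))).

(** * Correctness and running time of the program *)

Section Correctness.
Variables (R : realType) (U W : finType).
Variables (p gamma : U + W -> U * W -> R) (E M : {set U * W}) (B : nat).
Hypothesis matchM : is_matching E M.
Hypotheses (B_ge4 : (4 <= B)%N) (UB : (#|U| + #|U| + 1 < B)%N) (WB : (#|W| < B)%N).
Hypothesis UWB : (#|U| * #|W| < B)%N.

Let r := rmem (input E M p gamma).

Definition code (o : option (U * W)) : nat :=
  if o is Some e then (edge_index e).+1 else 0.

Lemma code_inj : injective code.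
Proof. by move=> [e|] [e'|] //= [] /edge_index_inj ->. Qed.

Lemma code_lt o : (code o <= B)%N.
Proof. by case: o => [e|] //=; apply: leq_trans (edge_index_lt e) (ltnW UWB). Qed.

Lemma ieval_code_pred e cexp m :
    ieval B (State m r) cexp = Some (Posz (code (Some e))) ->
  ieval B (State m r) (ISub cexp (IConst 1)) = Some (Posz (edge_index e)).
Proof.
move=> cE; have -> : Posz (edge_index e) = Posz (code (Some e)) - 1 by rewrite /=; lia.
apply: (ieval_sub cE); first by apply: ieval_const; lia.
by have := code_lt (Some e); rewrite /=; lia.
Qed.

Lemma runs_set_approval a cexp k v e m (Q : memory -> Prop) :
    ieval B (State m r) index_exp = Some (Posz (edge_index e)) ->
    ieval B (State m r) cexp = Some (Posz (code (edge_of M v))) ->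
    (forall f, f \in E -> incident v f ->
      r k (edge_index f) = p v f /\ r k.+2 (edge_index f) = gamma v f) ->
    e \in E -> incident v e ->
    Q (update m a 0 (approval p gamma M v e)) ->
  runs B r (set_approval a cexp k) m (time_bound (set_approval a cexp k)) Q.
Proof.
move=> eP cP rP eE ve Qm; have [re rge] := rP e eE ve.
have const1 : ieval B (State m r) (IConst 1) = Some 1 by apply: ieval_const; lia.
have set_val z : (absz z <= 1)%N -> approval p gamma M v e = z ->
    runs B r (set_var a (IConst z)) m 3 Q.
  move=> z1 zE; apply: (runs_set (k := 0) (z := z)); [by []| |by rewrite -zE; exact: Qm].
  by apply: ieval_const; lia.
rewrite /set_approval; apply: runs_if; first exact: beval_ile const1 cP.
  move=> matched.
  case Mv: (edge_of M v) cP matched => [f|] // cP _.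
  have [fM vf] := edge_of_Some Mv.
  have [rf _] : r k (edge_index f) = p v f /\ r k.+2 (edge_index f) = gamma v f.
    by apply: rP => //; case: matchM => /subsetP/(_ f fM).
  apply: (@runs_if _ _ _ _ _ _ _ _ _ (p v f + gamma v e <= p v e)).
  - rewrite [LHS]/= -/(reval _ _ _).
    have := reval_get k (ieval_code_pred cP).
    have := reval_get k eP; have := reval_get k.+2 eP.
    by rewrite [rmem _]/= rge re rf => /= -> -> -> /=.
  - by move=> le; apply: set_val => //; rewrite /approval Mv le.
  - by move=> nle; apply: set_val => //; rewrite /approval Mv (negPf nle).
move=> unmatched; apply: set_val => //; rewrite /approval.
by case: (edge_of M v) unmatched.
Qed.

(** The cells that the scans leave untouched. *)
Definition base_memory (m : memory) : Prop :=
  [/\ cell m 0 0 = #|U|, cell m 1 0 = #|W|,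
      forall e, cell m 2 (edge_index e) = (e \in E : nat),
      forall u, cell m 5 (enum_rank u) = code (edge_of M (inl u)) &
      forall w, cell m 6 (enum_rank w) = code (edge_of M (inr w))].

Definition scan_memory (q k : nat) (m : memory) : Prop :=
  base_memory m /\ exists (xi : option (U * W) -> int) (b : bool),
    [/\ forall o, cell m 7 (code o) = xi o, cell m 4 0 = (b : nat) &
        scan_inv p gamma E M q k xi b].

Lemma real_input_l u f : f \in E -> incident (inl u) f ->
  r 0 (edge_index f) = p (inl u) f /\ r 2 (edge_index f) = gamma (inl u) f.
Proof.
by move=> fE /eqP fu; rewrite /r /= !row_major_index /on_edges fE fu.
Qed.

Lemma real_input_r w f : f \in E -> incident (inr w) f ->
  r 1 (edge_index f) = p (inr w) f /\ r 3 (edge_index f) = gamma (inr w) f.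
Proof.
by move=> fE /eqP fw; rewrite /r /= !row_major_index /on_edges fE fw.
Qed.

Lemma ieval_code_l (e : U * W) m : loop_at e m -> base_memory m ->
  ieval B (State m r) code_l = Some (Posz (code (edge_of M (inl e.1)))).
Proof.
case=> _ ml _ [_ _ _ cl _]; rewrite (@ieval_get _ _ _ _ _ (enum_rank e.1))
  ?ieval_var /= ?cl ?ml //.
Qed.

Lemma ieval_code_r (e : U * W) m : loop_at e m -> base_memory m ->
  ieval B (State m r) code_r = Some (Posz (code (edge_of M (inr e.2)))).
Proof.
case=> _ _ mr [_ _ _ _ cr]; rewrite (@ieval_get _ _ _ _ _ (enum_rank e.2))
  ?ieval_var /= ?cr ?mr //.
Qed.

Lemma approval_bound v e : -1 <= approval p gamma M v e <= 1.
Proof. by rewrite /approval; case: (edge_of M v) => [f|] //; case: ifP. Qed.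

Lemma runs_relax_edge (q : nat) (e : U * W) m : loop_at e m -> cell m 11 0 = q ->
    scan_memory q (edge_index e) m ->
  runs B r relax_edge m (time_bound relax_edge)
    (fun m' => [/\ cell m' 9 0 = cell m 9 0, cell m' 10 0 = cell m 10 0 &
                   cell m' 11 0 = q /\ scan_memory q (edge_index e).+1 m']).
Proof.
move=> at_e mq [base [xi [b [xiP bP inv]]]].
have const m' z : (absz z <= 4)%N -> ieval B (State m' r) (IConst z) = Some z.
  by move=> z4; apply: ieval_const; lia.
have [_ _ EP _ _] := base.
rewrite /relax_edge; apply: runs_if.
- by apply: beval_ile (const _ _ _) (ieval_get _ (ieval_index _ UWB at_e)).
- rewrite /= EP; case eE: (e \in E) => // _.
  apply: runs_seq; apply: (runs_set_approval (v := inl e.1) (e := e)) => //.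
  + exact: (ieval_index r UWB at_e).
  + exact: ieval_code_l.
  + exact: real_input_l.
  + exact: eqxx.
  set al := approval _ _ _ _ _; set m1 := update _ _ _ _.
  have at_e1 : loop_at e m1 by case: at_e.
  have base1 : base_memory m1 by [].
  apply: runs_seq; apply: (runs_set_approval (v := inr e.2) (e := e)) => //.
  + exact: (ieval_index r UWB at_e1).
  + exact: ieval_code_r.
  + exact: real_input_r.
  + exact: eqxx.
  set ar := approval _ _ _ _ _; set m2 := update _ _ _ _.
  have at_e2 : loop_at e m2 by case: at_e.
  have base2 : base_memory m2 by [].
  have xil m' : loop_at e m' -> base_memory m' -> (forall o, cell m' 7 (code o) = xi o) ->
      ieval B (State m' r) (IGet 7 code_l) = Some (xi (edge_of M (inl e.1))).
    by move=> a' b' x'; rewrite (ieval_get _ (ieval_code_l a' b')) /= x'.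
  have xir : ieval B (State m2 r) (IGet 7 code_r) = Some (xi (edge_of M (inr e.2))).
    by rewrite (ieval_get _ (ieval_code_r at_e2 base2)); congr Some; exact: xiP.
  have [[xi0 xi1 _] _] := inv.
  apply: (@runs_if _ _ _ _ _ _ _ _ _ (tension M xi e <= edge_approval p gamma M e)).
  + apply: beval_ile.
      apply: ieval_sub xir _; first exact: xil.
      have := xi1 (edge_of M (inl e.1)); have := xi1 (edge_of M (inr e.2)); lia.
    apply: ieval_add; [exact: ieval_var|exact: ieval_var|].
    have := approval_bound (inl e.1) e; have := approval_bound (inr e.2) e.
    by rewrite /= -/al -/ar; lia.
  + move=> ok; apply: runs_skip; split=> //; split=> //; split=> //.
    by exists xi, b; split=> //; apply: scan_next inv.
  rewrite -ltNge => viol; have inv' := scan_violated eE viol inv.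
  apply: runs_seq; apply: (runs_set (k := 0)); [exact: const|exact: const|].
  set m3 := update _ _ _ _.
  have at_e3 : loop_at e m3 by case: at_e.
  have base3 : base_memory m3 by [].
  have cl := ieval_code_l at_e3 base3.
  apply: runs_if.
  + rewrite [LHS]/= -/(beval _ _ _).
    have := beval_ile (const m3 1 isT) cl.
    have := beval_ile (const m3 0 isT) (xil _ at_e3 base3 xiP).
    by move=> /= -> -> /=.
  + move=> low; apply: (runs_set cl).
      apply: ieval_sub (const _ 1 isT) _; first exact: xil.
      by have := xi1 (edge_of M (inl e.1)); lia.
    split=> //; split=> //; split=> //.
    exists (lower xi (edge_of M (inl e.1))), false; split=> //.
      (* Codes are injective, so the write to array 7 changes a single potential. *)
      move=> o; rewrite /update /= (inj_eq code_inj) /lower.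
      by case: eqP => // _; exact: xiP.
    move: inv' low; case: (edge_of M (inl e.1)) => [f|] //=.
    by move=> + xi_ge; rewrite xi_ge.
  + move=> high; apply: runs_skip.
    split=> //; split=> //; split=> //; exists xi, false; split=> //.
    move: inv' high; case: (edge_of M (inl e.1)) => [f|] //=.
    by move=> + xi_lt; rewrite (negPf xi_lt).
- rewrite /= EP; case eE: (e \in E) => // _; apply: runs_skip.
  split=> //; split=> //; split=> //; exists xi, b; split=> //.
  by apply: scan_next inv; rewrite eE.
Qed.

Definition pass_memory (q : nat) (m : memory) : Prop :=
  base_memory m /\ exists (xi : option (U * W) -> int) (b : bool),
    [/\ forall o, cell m 7 (code o) = xi o, cell m 4 0 = (b : nat) &
        pass_inv p gamma E M q xi b].

(** A code is a position plus 1, so after [k] pairs exactly the codes up to [k] have been entered.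
    Code 0 is never written, which keeps [xi None] at 0. *)
Definition init_memory (k : nat) (m : memory) : Prop :=
  [/\ cell m 0 0 = #|U|, cell m 1 0 = #|W|,
      (forall e, cell m 2 (edge_index e) = (e \in E : nat)) /\
      (forall e, cell m 3 (edge_index e) = (e \in M : nat)),
      cell m 4 0 = 0 &
      [/\ forall u, let c := code (edge_of M (inl u)) in
            cell m 5 (enum_rank u) = if (c <= k)%N then c else 0,
          forall w, let c := code (edge_of M (inr w)) in
            cell m 6 (enum_rank w) = if (c <= k)%N then c else 0 &
          forall o, cell m 7 (code o) =
            if o is Some e then ((e \in M) && (code o <= k)%N : nat) else 0]].

Lemma code_leS o e : o != Some e ->
  (code o <= (edge_index e).+1)%N = (code o <= edge_index e)%N.
Proof.
move=> oe; rewrite leq_eqVlt ltnS.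
by rewrite -[(edge_index e).+1]/(code (Some e)) (inj_eq code_inj) (negPf oe).
Qed.

Lemma runs_init_edge (e : U * W) m : loop_at e m -> init_memory (edge_index e) m ->
  runs B r init_edge m (time_bound init_edge)
    (fun m' => [/\ cell m' 9 0 = cell m 9 0, cell m' 10 0 = cell m 10 0 &
                   init_memory (edge_index e).+1 m']).
Proof.
move=> at_e [mU mW [EP MP] m4 [m5 m6 m7]]; have [_ ml mr] := at_e.
have eB := leq_ltn_trans (edge_index_lt e) UWB.
have const1 m' : ieval B (State m' r) (IConst 1) = Some 1 by apply: ieval_const; lia.
have codeP m' : loop_at e m' ->
    ieval B (State m' r) (IAdd index_exp (IConst 1)) = Some (Posz (edge_index e).+1).
  move=> at_e'; have -> : Posz (edge_index e).+1 = Posz (edge_index e) + 1 by lia.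
  by apply: ieval_add (ieval_index r UWB at_e') (const1 _) _; lia.
rewrite /init_edge; apply: runs_if.
- by apply: beval_ile (const1 _) (ieval_get _ (ieval_index r UWB at_e)).
- rewrite /= MP; case eM: (e \in M) => // _.
  have Ml := edge_of_l matchM eM; have Mr := edge_of_r matchM eM.
  apply: runs_seq; apply: (runs_set (k := enum_rank e.1)).
  + by rewrite ieval_var /= ml.
  + exact: codeP.
  set m1 := update _ _ _ _; have at_e1 : loop_at e m1 by case: at_e.
  apply: runs_seq; apply: (runs_set (k := enum_rank e.2)).
  + by rewrite ieval_var -mr.
  + exact: codeP.
  set m2 := update _ _ _ _; have at_e2 : loop_at e m2 by case: at_e.
  apply: runs_set (codeP _ at_e2) (const1 _) _.
  split=> //; split=> //; split.
  + move=> u /=; rewrite /m2 /m1 /update /=; case: eqP => [/val_inj/enum_rank_inj ->|ue].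
      by rewrite Ml /= leqnn.
    rewrite m5 code_leS //; apply/eqP => Mu; case: ue.
    by have [_ /eqP ->] := edge_of_Some Mu.
  + move=> w /=; rewrite /m2 /m1 /update /=; case: eqP => [/val_inj/enum_rank_inj ->|we].
      by rewrite Mr /= leqnn.
    rewrite m6 code_leS //; apply/eqP => Mw; case: we.
    by have [_ /eqP ->] := edge_of_Some Mw.
  + move=> o; rewrite /m2 /m1 /update /=.
    rewrite -[(edge_index e).+1]/(code (Some e)) (inj_eq code_inj).
    case: eqP => [->|/eqP oe]; first by rewrite eM leqnn.
    by rewrite m7; case: o oe => // f oe; rewrite [code (Some e)]/= code_leS.
- rewrite /= MP; case eM: (e \in M) => // _; apply: runs_skip.
  have Mne v : edge_of M v != Some e.
    by apply/eqP => Mv; have [] := edge_of_Some Mv; rewrite eM.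
  split=> //; split=> //; split.
  + by move=> u /=; rewrite m5 code_leS.
  + by move=> w /=; rewrite m6 code_leS.
  + move=> [f|]; rewrite m7 //; have [->|fe] := eqVneq f e; first by rewrite eM.
    by rewrite code_leS // (inj_eq Some_inj).
Qed.

(** The initial potentials are 1 on [M], the largest value allowed, hence above every witness. The
    flag is still 0, and the bound on [mass] holds with no scan made. *)
Lemma pass_memory_init m : init_memory (#|U| * #|W|) m -> pass_memory 0 m.
Proof.
have code_le o : (code o <= #|U| * #|W|)%N by case: o => [e|] //=; exact: edge_index_lt.
move=> [mU mW [EP _] m4 [m5 m6 m7]]; split.
  by split=> // [u|w]; rewrite ?m5 ?m6 code_le.
exists (fun o => if o is Some e then (e \in M)%:Z else 0), false.
split=> //; first by case=> [e|]; rewrite m7 // code_le andbT.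
have up : above_witnesses p gamma E M (fun o => if o is Some e then (e \in M)%:Z else 0).
  split=> // [[e|]|zeta v [zeta0 zeta1 _]] //; first by case: (e \in M).
  case Mv: (edge_of M v) => [e|]; last by rewrite zeta0.
  by have [-> _] := edge_of_Some Mv; have := zeta1 (Some e); lia.
by split=> //; right; rewrite addr0; exact: mass_le up.
Qed.

(** In each scan 3 pays for resetting the flag, 7 for evaluating the bound [2 * #|U| + 1], and 10
    for the loop overhead. *)
Lemma runs_decide_popular :
  runs B r decide_popular (imem (input E M p gamma))
    (#|U|.+1 * (#|W|.+1 * (time_bound init_edge + 12) + 12)
     + (#|U| + #|U| + 1).+1 *
         (3 + #|U|.+1 * (#|W|.+1 * (time_bound relax_edge + 12) + 12)
          + 7 + 10))
    (pass_memory (#|U| + #|U| + 1)).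
Proof.
have UB' : (#|U| < B)%N by lia.
apply: runs_seq; apply: runs_weaken (leqnn _) _ _; last first.
  apply: (runs_edge_loop UB' WB (Inv := init_memory)) => //.
  - by move=> k m0 a z /orP[]/eqP ->.
  - by move=> k m0 [].
  - by move=> e m0; apply: runs_init_edge.
  - split=> //; first by split=> e /=; rewrite row_major_index.
    by split=> [u|w|[e|]] /=; rewrite ?ltn0 ?andbF //; case: (code _).
move=> m /pass_memory_init Pm.
apply: (runs_for (Inv := pass_memory)) Pm => //.
  move=> q m0 [[mU _ _ _ _] _]; rewrite !PoszD.
  apply: ieval_add; [|by apply: ieval_const; lia|by lia].
  by apply: ieval_add; [rewrite ieval_var /= mU|rewrite ieval_var /= mU|lia].
move=> q m0 _ [base [xi [b [xiP _ inv]]]] m0q.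
apply: runs_seq; apply: (runs_set (k := 0)); [by []|by apply: ieval_const; lia|].
apply: runs_weaken (leqnn _) _ _; last first.
  apply: (runs_edge_loop UB' WB
    (Inv := fun k m' => cell m' 11 0 = q /\ scan_memory q k m')) => //.
  - by move=> k m1 a z /orP[]/eqP ->.
  - by move=> k m1 [_ [[]]].
  - by move=> e m1 at_e [m1q mem]; apply: runs_relax_edge.
  - split=> //; split=> //; exists xi, true; split=> //; exact: scan_start inv.
move=> m2 [m2q [base2 [xi2 [b2 [xi2P b2P inv2]]]]]; split=> //; split=> //.
by exists xi2, b2; split=> //; exact: scan_end inv2.
Qed.

(** With a cleared flag and some witness, [mass] would be at most -1 after [2 * #|U| + 1] scans. *)
Lemma pass_memory_final m : pass_memory (#|U| + #|U| + 1) m ->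
  cell m 4 0 = 1 <-> exists xi, witness p gamma E M xi.
Proof.
move=> [_ [xi [b [_ -> [up]]]]]; case: b => [wit|small]; first by split=> // _; exists xi.
split=> // -[zeta wz]; case: small => [no|le]; first by case: (no zeta).
by have := mass_ge0 up; clear -le; lia.
Qed.

End Correctness.

(* The word bound (n + 2)^d says that words have O(log n) bits. *)
Theorem theorem9 (R : realType) :
  exists (P : com) (d : nat) (T : nat -> nat),
    bigO T (fun n => n ^ 3)%N /\
    forall (U W : finType) (E : {set U * W})
           (p gamma : U + W -> U * W -> R) (M : {set U * W}),
      let n := #|{: U + W}| in
      (forall v e, e \in edges_at E v -> 0 <= p v e) ->
      (forall v e, e \in edges_at E v -> 0 < gamma v e) ->
      is_matching E M ->
      exists (t : nat) (s : state R),
        [/\ exec ((n + 2) ^ d)%N P (input E M p gamma) t s,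
            (t <= T n)%N &
            accepts s <-> popular p gamma E M].
Proof.
(* Exponent 2 makes the word bound exceed [#|U| * #|W|] and [2 * #|U| + 1]; 1000 is a generous
   constant. *)
exists decide_popular, 2, (fun n => 1000 * n.+1 ^ 3)%N; split.
  (* For positive [n], [n.+1 <= 2 * n]. *)
  exists (1000 * 2 ^ 3)%N, 1 => n n_gt0; rewrite -mulnA leq_mul2l /=.
  by rewrite -expnMn leq_exp2r //; lia.
move=> U W E p gamma M n _ gamma_gt0 matchM.
have nE : n = (#|U| + #|W|)%N by rewrite /n card_sum.
have [||||t [m [ex tle Pm]]] :=
  @runs_decide_popular R U W p gamma E M ((n + 2) ^ 2) matchM.
- by rewrite nE; move: (#|U|) (#|W|) => a b; nia.
- by rewrite nE; move: (#|U|) (#|W|) => a b; nia.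
- by rewrite nE; move: (#|U|) (#|W|) => a b; nia.
- by rewrite nE; move: (#|U|) (#|W|) => a b; nia.
exists t, (State m (rmem (input E M p gamma))); split=> //.
  apply: leq_trans tle _.
  have U_le : (#|U| <= n)%N by rewrite nE leq_addr.
  have W_le : (#|W| <= n)%N by rewrite nE leq_addl.
  have edge_time c : (#|U|.+1 * (#|W|.+1 * (c + 12) + 12) <= n.+1 ^ 2 * (c + 24))%N.
    rewrite -mulnn -mulnA leq_mul //.
    by apply: (@leq_trans (n.+1 * (c + 12) + 12)); [rewrite leq_add2r leq_mul|lia].
  have init_time : (time_bound init_edge <= 120)%N by [].
  have relax_time : (time_bound relax_edge <= 120)%N by [].
  have := edge_time (time_bound init_edge); have := edge_time (time_bound relax_edge).
  move: (time_bound init_edge) (time_bound relax_edge) init_time relax_time.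
  move=> ci cr ci_le cr_le.
  set ti := (_ * (_ * (ci + 12) + 12))%N; set tr := (_ * (_ * (cr + 12) + 12))%N.
  move=> tr_le ti_le.
  have {}tr_le : (tr <= n.+1 ^ 2 * 144)%N
    by apply: leq_trans tr_le _; apply: leq_mul => //; lia.
  have {}ti_le : (ti <= n.+1 ^ 2 * 144)%N
    by apply: leq_trans ti_le _; apply: leq_mul => //; lia.
  (* One initial pass and at most [2 * n.+1] rounds, with 144 = 120 + 24 from [edge_time] and 20 = 3
     + 7 + 10. *)
  apply: (@leq_trans (n.+1 ^ 2 * 144 + (2 * n.+1) * (n.+1 ^ 2 * 144 + 20))).
    apply: leq_add => //; apply: leq_mul; first by lia.
    by lia.
  have n1_gt0 : (0 < n.+1)%N by [].
  move: n.+1 n1_gt0 => k; rewrite !expnS expn0 muln1; nia.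
rewrite /accepts (pass_memory_final Pm); split=> [[xi wit]|].
  exact: witness_popular wit.
exact: popular_witness.
Qed.
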